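(* Let $\mathbf{k}$ be a field, let $\mathsf{T}$ be a $\mathbf{k}$-linear, Krull-Schmidt, triangulated category and let $(\mathsf{X}_i,\mathsf{Y}_i)_{i\in I}$, $I=\{0,\ldots,d-1\}$, be a finite set of t-structures in $\mathsf{T}$. If the refined truncation algorithm for $(\mathsf{X}_i,\mathsf{Y}_i)_{i\in I}$ terminates (for every object $t$ of $\mathsf{T}$), then the extension closure $\langle \mathsf{X}_i\mid i\in I\rangle$ of the aisles $\mathsf{X}_i$ is an aisle.
   Context: Let $\Sigma$ be the suspension of $\mathsf{T}$. A t-structure is a pair of full subcategories $(\mathsf{X},\mathsf{Y})$ with (i) $\Sigma\mathsf{X}\subseteq\mathsf{X}$; (ii) $\mathrm{Hom}_{\mathsf{T}}(\mathsf{X},\mathsf{Y})=0$; (iii) every $t\in\mathsf{T}$ has a distinguished (truncation) triangle $t_{\mathsf{X}}\to t\to t_{\mathsf{Y}}\to\Sigma t_{\mathsf{X}}$ with $t_{\mathsf{X}}\in\mathsf{X}$, $t_{\mathsf{Y}}\in\mathsf{Y}$. $\mathsf{X}$ is called an aisle, $\mathsf{Y}$ a co-aisle, and $t_{\mathsf{Y}}$ the left truncation of $t$. $\langle\mathsf{C}\rangle$ is the smallest full subcategory containing $\mathsf{C}$ closed under extensions and direct summands. Krull-Schmidt: idempotents split, each object is a finite direct sum of indecomposables, and indecomposables have local endomorphism rings. Refined truncation algorithm. Given $t\in\mathsf{T}$, it produces objects $\mathsf{RX}(t)_n$, $\mathsf{RY}(t)_n$ ($n\ge 0$) and distinguished triangles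 $\mathsf{RX}(t)_n\to t\xrightarrow{\alpha_n}\mathsf{RY}(t)_n\to\Sigma\mathsf{RX}(t)_n$ such that the composition of $\alpha_n$ with the projection onto each non-zero direct summand of $\mathsf{RY}(t)_n$ is non-zero. Initial step: $\mathsf{RX}(t)_0=t_{\mathsf{X}_0}$, $\mathsf{RY}(t)_0=t_{\mathsf{Y}_0}$, with $\alpha_0$ the truncation map. Iterative step: interpret the index of the t-structures modulo $d$. Let $(\mathsf{RY}(t)_{n-1})_{\mathsf{Y}_n}$ be the left truncation of $\mathsf{RY}(t)_{n-1}$ with respect to $(\mathsf{X}_n,\mathsf{Y}_n)$ and let $\tilde\alpha_n\colon t\xrightarrow{\alpha_{n-1}}\mathsf{RY}(t)_{n-1}\to(\mathsf{RY}(t)_{n-1})_{\mathsf{Y}_n}$ be the composition. Decompose $(\mathsf{RY}(t)_{n-1})_{\mathsf{Y}_n}=\mathsf{RY}(t)_n\oplus\mathsf{W}(t)_n$, with projections $p_n,\pi_n$, such that $\alpha_n:=p_n\tilde\alpha_n$ is non-zero onto all non-zero summands of $\mathsf{RY}(t)_n$ and $\pi_n\tilde\alpha_n=0$ (such a decomposition is unique up to isomorphism). Then $\mathsf{RX}(t)_n$ is the cocone of $\alpha_n$. There are induced maps $\mathsf{RY}(t)_{n-1}\to\mathsf{RY}(t)_n$. The algorithm terminates for $t$ if the sequence $\mathsf{RY}(t)_0\to\mathsf{RY}(t)_1\to\mathsf{RY}(t)_2\to\cdots$ is eventually constant, i.e. there is $n_0$ such that these maps are isomorphisms for $n\ge n_0$.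 *)

(* Defs.v *)
From mathcomp Require Import all_boot all_algebra.

Set Implicit Arguments.
Unset Strict Implicit.
Unset Printing Implicit Defensive.

Import GRing.Theory.
Local Open Scope ring_scope.

Reserved Notation "g ∘ f" (at level 40, left associativity).

Record linCat (k : fieldType) := LinCat {
  obj :> Type;
  hom : obj -> obj -> lmodType k;
  idm : forall A, hom A A;
  comp : forall A B C, hom B C -> hom A B -> hom A C;
  compA : forall A B C D (h : hom C D) (g : hom B C) (f : hom A B),
    comp h (comp g f) = comp (comp h g) f;
  comp1m : forall A B (f : hom A B), comp (idm B) f = f;
  compm1 : forall A B (f : hom A B), comp f (idm A) = f;
  comp_linear_l : forall A B C (f : hom A B),
    linear (fun g : hom B C => comp g f);
  comp_linear_r : forall A B C (g : hom B C),
    linear (fun f : hom A B => comp g f)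
}.

Arguments hom {k l} A B.
Arguments idm {k l} A.
Arguments comp {k l A B C} g f.
Notation "g ∘ f" := (comp g f).

Definition is_iso (k : fieldType) (C : linCat k) (A B : C) (f : hom A B) :=
  exists g : hom B A, g ∘ f = idm A /\ f ∘ g = idm B.

(* Initial and terminal: every hom space already contains 0. *)
Definition is_zero (k : fieldType) (C : linCat k) (Z : C) :=
  forall A : C, (forall f : hom Z A, f = 0) /\ (forall f : hom A Z, f = 0).

Definition is_biproduct (k : fieldType) (C : linCat k) (A B M : C)
    (iA : hom A M) (iB : hom B M) (pA : hom M A) (pB : hom M B) :=
  [/\ pA ∘ iA = idm A, pB ∘ iB = idm B, pA ∘ iB = 0, pB ∘ iA = 0
    & iA ∘ pA + iB ∘ pB = idm M].

Definition is_direct_sum (k : fieldType) (C : linCat k) (n : nat)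
    (A : 'I_n -> C) (M : C) :=
  exists (inj : forall j, hom (A j) M) (prj : forall j, hom M (A j)),
    [/\ forall j, prj j ∘ inj j = idm (A j),
        forall j l, j != l -> prj j ∘ inj l = 0
      & \sum_j inj j ∘ prj j = idm M].

Definition additive_cat (k : fieldType) (C : linCat k) :=
  (exists Z : C, is_zero Z) /\
  forall A B : C, exists (M : C) (iA : hom A M) (iB : hom B M)
    (pA : hom M A) (pB : hom M B), is_biproduct iA iB pA pB.

Record linFunctor (k : fieldType) (C D : linCat k) := LinFunctor {
  fobj :> C -> D;
  fmap : forall A B, hom A B -> hom (fobj A) (fobj B);
  fmap_linear : forall A B, linear (@fmap A B);
  fmap1 : forall A, fmap (idm A) = idm (fobj A);
  fmapM : forall A B E (g : hom B E) (f : hom A B),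
    fmap (g ∘ f) = fmap g ∘ fmap f
}.

Arguments fmap {k C D} F {A B} f : rename.

Definition is_equivalence (k : fieldType) (C D : linCat k)
    (F : linFunctor C D) :=
  exists G : linFunctor D C,
    (exists eta : forall A : C, hom A (G (F A)),
       (forall A, is_iso (eta A)) /\
       forall A B (f : hom A B), eta B ∘ f = fmap G (fmap F f) ∘ eta A) /\
    (exists eps : forall B : D, hom (F (G B)) B,
       (forall B, is_iso (eps B)) /\
       forall A B (f : hom A B), f ∘ eps A = eps B ∘ fmap F (fmap G f)).

(* [dist f g h] says that A --f--> B --g--> C --h--> Sigma A is a
   distinguished triangle.  The axioms are Verdier's, with the suspension an
   autoequivalence (not necessarily a strict automorphism). *)
Record triCat (k : fieldType) := TriCat {
  tcat :> linCat k;
  tcat_additive : additive_cat tcat;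
  susp : linFunctor tcat tcat;
  susp_equiv : is_equivalence susp;
  dist : forall A B C : tcat, hom A B -> hom B C -> hom C (susp A) -> Prop;
  dist_iso : forall (A B C A' B' C' : tcat)
      (f : hom A B) (g : hom B C) (h : hom C (susp A))
      (f' : hom A' B') (g' : hom B' C') (h' : hom C' (susp A'))
      (a : hom A A') (b : hom B B') (c : hom C C'),
    is_iso a -> is_iso b -> is_iso c ->
    b ∘ f = f' ∘ a -> c ∘ g = g' ∘ b -> fmap susp a ∘ h = h' ∘ c ->
    dist f g h -> dist f' g' h';
  dist_id : forall A Z : tcat, is_zero Z ->
    dist (idm A) (0 : hom A Z) (0 : hom Z (susp A));
  dist_cone : forall (A B : tcat) (f : hom A B),
    exists (C : tcat) (g : hom B C) (h : hom C (susp A)), dist f g h;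
  dist_rot : forall (A B C : tcat)
      (f : hom A B) (g : hom B C) (h : hom C (susp A)),
    dist f g h <-> dist g h (- fmap susp f);
  dist_morph : forall (A B C A' B' C' : tcat)
      (f : hom A B) (g : hom B C) (h : hom C (susp A))
      (f' : hom A' B') (g' : hom B' C') (h' : hom C' (susp A'))
      (a : hom A A') (b : hom B B'),
    dist f g h -> dist f' g' h' -> b ∘ f = f' ∘ a ->
    exists c : hom C C', c ∘ g = g' ∘ b /\ fmap susp a ∘ h = h' ∘ c;
  dist_oct : forall (A B C Cf Cg Cgf : tcat)
      (f : hom A B) (f' : hom B Cf) (f'' : hom Cf (susp A))
      (g : hom B C) (g' : hom C Cg) (g'' : hom Cg (susp B))
      (h' : hom C Cgf) (h'' : hom Cgf (susp A)),
    dist f f' f'' -> dist g g' g'' -> dist (g ∘ f) h' h'' ->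
    exists (u : hom Cf Cgf) (v : hom Cgf Cg),
      [/\ dist u v (fmap susp f' ∘ g''),
          u ∘ f' = h' ∘ g, h'' ∘ u = f'',
          v ∘ h' = g' & g'' ∘ v = fmap susp f ∘ h'']
}.

Arguments susp {k t}.
Arguments dist {k t A B C} f g h.

Definition idempotents_split (k : fieldType) (C : linCat k) :=
  forall (A : C) (e : hom A A), e ∘ e = e ->
  exists (B : C) (i : hom B A) (p : hom A B), p ∘ i = idm B /\ i ∘ p = e.

Definition indecomposable (k : fieldType) (C : linCat k) (M : C) :=
  ~ is_zero M /\
  forall (A B : C) (iA : hom A M) (iB : hom B M) (pA : hom M A) (pB : hom M B),
    is_biproduct iA iB pA pB -> is_zero A \/ is_zero B.

(* The endomorphism ring is nonzero and its non-units are closed under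
   addition. *)
Definition local_end (k : fieldType) (C : linCat k) (M : C) :=
  idm M <> 0 /\
  forall f g : hom M M, ~ is_iso f -> ~ is_iso g -> ~ is_iso (f + g).

Definition krull_schmidt (k : fieldType) (C : linCat k) :=
  [/\ idempotents_split C,
      forall M : C, exists (n : nat) (A : 'I_n -> C),
        (forall j, indecomposable (A j)) /\ is_direct_sum A M
    & forall M : C, indecomposable M -> local_end M].

(* A full subcategory is given by its class of objects. *)
Definition t_structure (k : fieldType) (T : triCat k) (X Y : T -> Prop) :=
  [/\ forall A, X A -> X (susp A),
      forall A B, X A -> Y B -> forall f : hom A B, f = 0
    & forall t, exists (tX tY : T)
        (u : hom tX t) (v : hom t tY) (w : hom tY (susp tX)),
        [/\ X tX, Y tY & dist u v w]].

Definition is_aisle (k : fieldType) (T : triCat k) (X : T -> Prop) :=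
  exists Y : T -> Prop, t_structure X Y.

Inductive ext_closure (k : fieldType) (T : triCat k) (P : T -> Prop) :
    T -> Prop :=
| ext_closure_gen A : P A -> ext_closure P A
| ext_closure_ext A B C (f : hom A B) (g : hom B C) (h : hom C (susp A)) :
    dist f g h -> ext_closure P A -> ext_closure P C -> ext_closure P B
| ext_closure_summand A B M
    (iA : hom A M) (iB : hom B M) (pA : hom M A) (pB : hom M B) :
    is_biproduct iA iB pA pB -> ext_closure P M -> ext_closure P A.

Definition nonzero_on_summands (k : fieldType) (C : linCat k) (t M : C)
    (a : hom t M) :=
  forall (A B : C) (iA : hom A M) (iB : hom B M) (pA : hom M A) (pB : hom M B),
    is_biproduct iA iB pA pB -> ~ is_zero A -> pA ∘ a <> 0.

(* One iteration with respect to (X, Y), from a0 : t -> R0 to a1 : t -> R1: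
   [tr] is the truncation map of R0, its target M is decomposed as R1 (+) W,
   and [r] is the induced map R0 -> R1. *)
Definition rta_step (k : fieldType) (T : triCat k) (X Y : T -> Prop)
    (t R0 R1 : T) (a0 : hom t R0) (a1 : hom t R1) (r : hom R0 R1) :=
  exists (U M : T) (u : hom U R0) (tr : hom R0 M) (w : hom M (susp U)),
    [/\ X U, Y M, dist u tr w &
        exists (W : T) (iR : hom R1 M) (iW : hom W M)
               (p : hom M R1) (q : hom M W),
          [/\ is_biproduct iR iW p q,
              a1 = p ∘ (tr ∘ a0),
              nonzero_on_summands a1,
              q ∘ (tr ∘ a0) = 0
            & r = p ∘ tr]].

Definition ord_mod (d : nat) (hd : (0 < d)%N) (n : nat) : 'I_d :=
  Ordinal (ltn_pmod n hd).

(* Truncations and decompositions are only determined up to isomorphism, so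
   the algorithm is nondeterministic: a run records one sequence of choices. *)
Record rta_run (k : fieldType) (T : triCat k) (d : nat) (hd : (0 < d)%N)
    (X Y : 'I_d -> T -> Prop) (t : T) := RtaRun {
  RX : nat -> T;
  RY : nat -> T;
  rta_in : forall n, hom (RX n) t;
  rta_alpha : forall n, hom t (RY n);
  rta_bd : forall n, hom (RY n) (susp (RX n));
  rta_map : forall n, hom (RY n) (RY n.+1);
  rta_dist : forall n, dist (rta_in n) (rta_alpha n) (rta_bd n);
  rta_initX : X (ord_mod hd 0) (RX 0);
  rta_initY : Y (ord_mod hd 0) (RY 0);
  rta_iter : forall n,
    rta_step (X (ord_mod hd n.+1)) (Y (ord_mod hd n.+1))
      (rta_alpha n) (rta_alpha n.+1) (rta_map n)
}.

(* In a Krull-Schmidt category runs exist, and since the maps alpha_n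
   are left minimal, eventual constancy is the same for all runs. *)
Definition rta_terminates (k : fieldType) (T : triCat k) (d : nat)
    (hd : (0 < d)%N) (X Y : 'I_d -> T -> Prop) (t : T) :=
  forall run : rta_run hd X Y t,
    exists n0, forall n, (n0 <= n)%N -> is_iso (rta_map run n).

(* Main.v *)
From mathcomp Require Import all_boot all_algebra.
From Stdlib Require Import Classical ClassicalEpsilon.
Require Import Defs.

(** The co-aisle is the right orthogonal of [<X_i>].  Along a run of the
    algorithm every [RX_n] lies in [<X_i>]: by the octahedral axiom the cocone of
    [tr ∘ alpha_n] is an extension of an object of [X_(n+1)] by [RX_n], and
    [RX_(n+1)] is a direct summand of that cocone, because [tr ∘ alpha_n] is
    [alpha_(n+1)] followed by a split monomorphism.  Each [RY_n] is a summand of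
    an object of [Y_n], so once the sequence [RY_n] is constant its value is
    orthogonal to every [X_i], and the triangle [RX_n -> t -> RY_n] is a
    truncation triangle.  Runs exist because in a Krull-Schmidt category
    splitting a nonzero summand off an object decreases its number of
    indecomposable summands. *)

Set Implicit Arguments.
Unset Strict Implicit.
Unset Printing Implicit Defensive.

Import GRing.Theory.
Local Open Scope ring_scope.

(** * Linear categories: retracts, Krull-Schmidt exchange and minimal decompositions *)

Section LinearCategory.
Variables (k : fieldType) (C : linCat k).

Lemma compDl (A B D : C) (g g' : hom B D) (f : hom A B) :
  (g + g') ∘ f = g ∘ f + g' ∘ f.
Proof. by have := comp_linear_l f 1 g g'; rewrite !scale1r. Qed.

Lemma compDr (A B D : C) (g : hom B D) (f f' : hom A B) :
  g ∘ (f + f') = g ∘ f + g ∘ f'.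
Proof. by have := comp_linear_r g 1 f f'; rewrite !scale1r. Qed.

Lemma comp0l (A B D : C) (f : hom A B) : (0 : hom B D) ∘ f = 0.
Proof. by apply: (addrI (0 ∘ f)); rewrite -compDl !addr0. Qed.

Lemma comp0r (A B D : C) (g : hom B D) : g ∘ (0 : hom A B) = 0.
Proof. by apply: (addrI (g ∘ 0)); rewrite -compDr !addr0. Qed.

Lemma compNl (A B D : C) (g : hom B D) (f : hom A B) : (- g) ∘ f = - (g ∘ f).
Proof. by apply: (addrI (g ∘ f)); rewrite -compDl !subrr comp0l. Qed.

Lemma compNr (A B D : C) (g : hom B D) (f : hom A B) : g ∘ (- f) = - (g ∘ f).
Proof. by apply: (addrI (g ∘ f)); rewrite -compDr !subrr comp0r. Qed.

Lemma compBl (A B D : C) (g g' : hom B D) (f : hom A B) :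
  (g - g') ∘ f = g ∘ f - g' ∘ f.
Proof. by rewrite compDl compNl. Qed.

Lemma compBr (A B D : C) (g : hom B D) (f f' : hom A B) :
  g ∘ (f - f') = g ∘ f - g ∘ f'.
Proof. by rewrite compDr compNr. Qed.

Lemma comp_suml (A B D : C) (I : finType) (g : I -> hom B D) (f : hom A B) :
  (\sum_i g i) ∘ f = \sum_i g i ∘ f.
Proof.
exact: (big_morph (fun g => g ∘ f) (fun g g' => compDl g g' f) (comp0l D f)).
Qed.

Lemma comp_sumr (A B D : C) (I : finType) (g : hom B D) (f : I -> hom A B) :
  g ∘ (\sum_i f i) = \sum_i g ∘ f i.
Proof. exact: (big_morph (comp g) (compDr g) (comp0r A g)). Qed.

Lemma is_iso_idm (A : C) : is_iso (idm A).
Proof. by exists (idm A); rewrite comp1m. Qed.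

Lemma is_iso_opp (A B : C) (f : hom A B) : is_iso f -> is_iso (- f).
Proof.
by case=> g [gf fg]; exists (- g); rewrite !compNl !compNr !opprK.
Qed.

Lemma is_iso_comp (A B D : C) (g : hom B D) (f : hom A B) :
  is_iso g -> is_iso f -> is_iso (g ∘ f).
Proof.
case=> g' [g'g gg'] [f' [f'f ff']]; exists (f' ∘ g'); split.
  by rewrite -compA (compA g') g'g comp1m.
by rewrite -compA (compA f) ff' comp1m.
Qed.

Lemma is_zeroP (A : C) : is_zero A <-> idm A = 0.
Proof.
split=> [ZA | A0 B]; first by case: (ZA A) => + _; apply.
split=> f; first by rewrite -(compm1 f) A0 comp0r.
by rewrite -(comp1m f) A0 comp0l.
Qed.

(** The complement is the image of the idempotent [idm M - i ∘ p]. *)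
Lemma biproduct_of_retract (A M : C) (i : hom A M) (p : hom M A) :
  idempotents_split C -> p ∘ i = idm A ->
  exists (B : C) (iB : hom B M) (pB : hom M B), is_biproduct i iB p pB.
Proof.
move=> splitC pi; pose e := idm M - i ∘ p.
have ei : e ∘ i = 0 by rewrite compBl comp1m -compA pi compm1 subrr.
have pe : p ∘ e = 0 by rewrite compBr compm1 compA pi comp1m subrr.
have ee : e ∘ e = e by rewrite {2}/e compBr compm1 compA ei comp0l subr0.
have [B [iB [pB [pBiB iBpB]]]] := splitC M _ ee.
exists B, iB, pB; split=> //.
- by rewrite -[LHS]compm1 -pBiB -compA (compA iB) iBpB compA pe comp0l.
- by rewrite -[LHS]comp1m -pBiB -compA (compA iB) iBpB ei comp0r.
- by rewrite iBpB addrC subrK.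
Qed.

Lemma indecomposable_retract_iso (L M : C) (i : hom L M) (p : hom M L) :
  idempotents_split C -> indecomposable M -> ~ is_zero L -> p ∘ i = idm L ->
  is_iso i.
Proof.
move=> splitC [_ indM] nzL pi.
have [B [iB [pB biB]]] := biproduct_of_retract splitC pi.
case: (indM _ _ _ _ _ _ biB) => // zB; exists p; split=> //.
by case: biB => _ _ _ _ <-; rewrite ((zB M).2 pB) comp0r addr0.
Qed.

(** Non-units are closed under addition, and the empty sum is a non-unit because [idm L <> 0]. *)
Lemma local_end_sum (L : C) n (u : 'I_n -> hom L L) :
  local_end L -> is_iso (\sum_j u j) -> exists j, is_iso (u j).
Proof.
case=> nzL addL isou; apply: NNPP => no_iso.
have nu j : ~ is_iso (u j) by move=> ?; apply: no_iso; exists j.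
suff: ~ is_iso (\sum_j u j) by [].
elim/big_rec: _ => [|j x _ nx]; last exact: addL.
by case=> g [g0 _]; apply: nzL; rewrite -g0 comp0r.
Qed.

Lemma indecomposable_summand (M : C) :
  krull_schmidt C -> ~ is_zero M ->
  exists (L : C) (i : hom L M) (p : hom M L), indecomposable L /\ p ∘ i = idm L.
Proof.
case=> _ decC _ nzM; have [[|n] [A [indA [inj [prj [pi _ sumM]]]]]] := decC M.
  by case: nzM; apply/is_zeroP; rewrite -sumM big_ord0.
by exists (A ord0), (inj ord0), (prj ord0); split.
Qed.

Lemma direct_sum_complement (n : nat) (A : 'I_n.+1 -> C) (M L B : C)
    (i : hom L M) (iB : hom B M) (p : hom M L) (pB : hom M B) :
  krull_schmidt C -> (forall j, indecomposable (A j)) -> is_direct_sum A M ->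
  indecomposable L -> is_biproduct i iB p pB ->
  exists j, is_direct_sum (fun l => A (lift j l)) B.
Proof.
move=> [splitC _ locC] indA [inj [prj [pi pi0 sumM]]] indL.
case=> pii pBiB piB pBi sumLB; have nzL := indL.1.
(* The exchange lemma: [idm L] is a sum of endomorphisms factoring through the
   [A j], and as [End L] is local one of them is invertible. *)
have [j [v [vu _]]] : exists j, is_iso (p ∘ inj j ∘ (prj j ∘ i)).
  apply: (local_end_sum (locC _ indL)).
  suff -> : \sum_j p ∘ inj j ∘ (prj j ∘ i) = idm L by exact: is_iso_idm.
  rewrite -pii -[in RHS](comp1m i) -sumM comp_suml comp_sumr.
  by apply: eq_bigr => j _; rewrite !compA.
have [|s [si is_]] := @indecomposable_retract_iso L (A j) (prj j ∘ i)
  (v ∘ (p ∘ inj j)) splitC (indA j) nzL; first by rewrite -compA.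
(* [e] projects onto the kernel of [prj j] along the image of [i]. It therefore identifies the
   complement [B] of [L] with the sum of the remaining [A l]. *)
pose e := idm M - i ∘ (s ∘ prj j).
have ei : e ∘ i = 0 by rewrite compBl comp1m -!compA si compm1 subrr.
have pje : prj j ∘ e = 0.
  by rewrite compBr compm1 !compA is_ comp1m subrr.
have eiBpB : e ∘ (iB ∘ pB) = e.
  by rewrite -[RHS]compm1 -sumLB compDr (compA e i) ei comp0l add0r.
have pBe : pB ∘ e = pB by rewrite compBr compm1 compA pBi comp0l subr0.
exists j, (fun l => pB ∘ inj (lift j l)), (fun l => prj (lift j l) ∘ e ∘ iB).
have E l m : prj (lift j l) ∘ e ∘ iB ∘ (pB ∘ inj (lift j m)) =
    prj (lift j l) ∘ inj (lift j m).
  rewrite compA -(compA _ iB) -(compA _ e) eiBpB -compA compBl comp1m.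
  by rewrite -!compA pi0 ?neq_lift // !comp0r subr0.
split=> [l | l m neq_lm |].
- by rewrite E pi.
- by rewrite E pi0 // (inj_eq (@lift_inj _ j)).
- under eq_bigr do rewrite -compA (compA (inj _)) (compA (inj _)).
  rewrite -comp_sumr -comp_suml -comp_suml.
  have -> : \sum_l inj (lift j l) ∘ prj (lift j l) = idm M - inj j ∘ prj j.
    by rewrite -sumM (bigD1_ord j) //= addrAC subrr add0r.
  by rewrite compBl comp1m -compA pje comp0r subr0 compA pBe.
Qed.

(** A nonzero summand on which [a] vanishes contains an indecomposable one, and [a] vanishes on that
    too. *)
Lemma nonzero_on_summandsN (t M : C) (a : hom t M) :
  krull_schmidt C -> ~ nonzero_on_summands a ->
  exists (L B : C) (i : hom L M) (iB : hom B M) (p : hom M L) (pB : hom M B),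
    [/\ indecomposable L, is_biproduct i iB p pB & p ∘ a = 0].
Proof.
move=> KS Na; apply: NNPP => noL; apply: Na => A B iA iB pA pB biAB nzA pAa.
have [L [i [p [indL pi]]]] := indecomposable_summand KS nzA.
have [||B' [iB' [pB' biL]]] := @biproduct_of_retract L M (iA ∘ i) (p ∘ pA).
- by case: KS.
- by case: biAB => pAiA _ _ _ _; rewrite -compA (compA pA) pAiA comp1m.
apply: noL; exists L, B', (iA ∘ i), iB', (p ∘ pA), pB'.
by rewrite -compA pAa comp0r.
Qed.

(** Induction on the number of indecomposable summands of [M]: an indecomposable summand missed by
    [a] is split off, and the complement has one summand fewer. *)
Lemma min_decomposition (t M : C) (a : hom t M) :
  krull_schmidt C ->
  exists (R W : C) (iR : hom R M) (iW : hom W M) (p : hom M R) (q : hom M W),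
    [/\ is_biproduct iR iW p q, nonzero_on_summands (p ∘ a) & q ∘ a = 0].
Proof.
move=> KS; have [splitC decC _] := KS.
have trivial_case (N : C) (b : hom t N) : nonzero_on_summands b ->
  exists (R W : C) (iR : hom R N) (iW : hom W N) (p : hom N R) (q : hom N W),
    [/\ is_biproduct iR iW p q, nonzero_on_summands (p ∘ b) & q ∘ b = 0].
  move=> nzb; have [W [iW [q biW]]] :=
    biproduct_of_retract splitC (comp1m (idm N)).
  exists N, W, (idm N), iW, (idm N), q; rewrite comp1m; split=> //.
  by case: biW => _ _ _ q0 _; rewrite -(compm1 q) q0 comp0l.
have [n [A [indA dsA]]] := decC M.
elim: n => [|n IHn] in A M a indA dsA *;
  have [/trivial_case // | Na] := classic (nonzero_on_summands a);
  have [L [B [i [iB [p [pB [indL biL pa]]]]]]] := nonzero_on_summandsN KS Na.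
  have [inj [prj [_ _]]] := dsA; rewrite big_ord0 => M0.
  case: biL indL => pi _ _ _ _ [nzL _]; case: nzL; apply/is_zeroP.
  by rewrite -pi -(comp1m i) -M0 comp0l comp0r.
have [j dsB] := direct_sum_complement KS indA dsA indL biL.
have [R [W [iR [iW [r [q [biR nzr qa]]]]]]] :=
  IHn _ B (pB ∘ a) (fun l => indA (lift j l)) dsB.
case: biL => _ pBiB _ _ sumLB; case: biR => riR _ _ _ sumRW.
(* Any complement of [R] in [M] will do: [a] factors through [iB ∘ iR], which [q'] kills. *)
have [|W' [iW' [q' biW']]] :=
    @biproduct_of_retract R M (iB ∘ iR) (r ∘ pB) splitC.
  by rewrite -compA (compA pB) pBiB comp1m.
exists R, W', (iB ∘ iR), iW', (r ∘ pB), q'; rewrite -compA; split=> //.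
case: biW' => _ _ _ q'0 _.
rewrite -(comp1m a) -sumLB compDl -!compA pa comp0r add0r.
rewrite -(comp1m (pB ∘ a)) -sumRW compDl -!compA qa comp0r addr0.
by rewrite !compA -(compA q') q'0 !comp0l.
Qed.

End LinearCategory.

(** * Linear functors and equivalences *)

Section LinearFunctor.
Variables (k : fieldType) (C D : linCat k) (F : linFunctor C D).

Lemma fmapD (A B : C) (f g : hom A B) : fmap F (f + g) = fmap F f + fmap F g.
Proof. by have := @fmap_linear _ _ _ F A B 1 f g; rewrite !scale1r. Qed.

Lemma fmap0 (A B : C) : fmap F (0 : hom A B) = 0.
Proof. by apply: (addrI (fmap F 0)); rewrite -fmapD !addr0. Qed.

Lemma fmapN (A B : C) (f : hom A B) : fmap F (- f) = - fmap F f.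
Proof. by apply: (addrI (fmap F f)); rewrite -fmapD !subrr fmap0. Qed.

Lemma fmap_zero (Z : C) : is_zero Z -> is_zero (F Z).
Proof. by move/is_zeroP=> Z0; apply/is_zeroP; rewrite -fmap1 Z0 fmap0. Qed.

Lemma fmap_biproduct (A B M : C) (iA : hom A M) (iB : hom B M)
    (pA : hom M A) (pB : hom M B) :
  is_biproduct iA iB pA pB ->
  is_biproduct (fmap F iA) (fmap F iB) (fmap F pA) (fmap F pB).
Proof.
by case=> E1 E2 E3 E4 E5; split; rewrite -?fmapM -?fmapD ?E1 ?E2 ?E3 ?E4 ?E5
  ?fmap0 ?fmap1.
Qed.

Lemma equivalence_faithful (A B : C) (f g : hom A B) :
  is_equivalence F -> fmap F f = fmap F g -> f = g.
Proof.
case=> G [[eta [iso_eta nat_eta]] _] Ffg; have [s [s_eta _]] := iso_eta B.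
by rewrite -(comp1m f) -(comp1m g) -s_eta -!compA !nat_eta Ffg.
Qed.

(** Conjugating [fmap G f] by [eta] gives [g] such that [fmap F g] and [f] agree after [G]. They are
    then equal, since [eps] conjugates the effect of [F] after [G] back to the identity. *)
Lemma equivalence_full (A B : C) (f : hom (F A) (F B)) :
  is_equivalence F -> exists g : hom A B, fmap F g = f.
Proof.
case=> G [[eta [iso_eta nat_eta]] [eps [iso_eps nat_eps]]].
have [s [_ eta_s]] := iso_eta B; have [r [_ eta_r]] := iso_eta A.
exists (s ∘ (fmap G f ∘ eta A)); set g := s ∘ _.
have GFg : fmap G (fmap F g) = fmap G f.
  rewrite -[LHS]compm1 -eta_r compA -nat_eta /g (compA (eta B)) eta_s comp1m.
  by rewrite -compA eta_r compm1.
have [e [_ eps_e]] := iso_eps (F A).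
rewrite -[LHS]compm1 -[RHS]compm1 -eps_e !compA !nat_eps.
by rewrite GFg.
Qed.

Lemma equivalence_ess_surj (B : D) :
  is_equivalence F -> exists (A : C) (e : hom (F A) B), is_iso e.
Proof. by case=> G [_ [eps [iso_eps _]]]; exists (G B), (eps B). Qed.

End LinearFunctor.

(** * Triangles and cocones *)

Section TriangulatedCategory.
Variables (k : fieldType) (T : triCat k).

Lemma dist_opp12 (A B C : T) (f : hom A B) (g : hom B C) (h : hom C (susp A)) :
  dist f g h -> dist (- f) (- g) h.
Proof.
apply: (@dist_iso _ _ _ _ _ _ _ _ _ _ _ _ _ _ (idm A) (- idm B) (idm C)).
- exact: is_iso_idm.
- by apply: is_iso_opp; exact: is_iso_idm.
- exact: is_iso_idm.
- by rewrite compNl comp1m compm1.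
- by rewrite compNl compNr opprK comp1m compm1.
- by rewrite fmap1 comp1m compm1.
Qed.

(** Three rotations negate all three suspended maps; [dist_opp12] removes two of the signs. *)
Lemma dist_susp (A B C : T) (f : hom A B) (g : hom B C) (h : hom C (susp A)) :
  dist f g h <-> dist (fmap susp f) (fmap susp g) (- fmap susp h).
Proof.
rewrite dist_rot dist_rot dist_rot; split=> /dist_opp12 //.
by rewrite !opprK.
Qed.

(** The factor [y] is the third component of a morphism to the triangle on [0] and [idm D]. *)
Lemma dist_factor (A B C D : T) (f : hom A B) (g : hom B C)
    (h : hom C (susp A)) (x : hom B D) :
  dist f g h -> x ∘ f = 0 -> exists y, x = y ∘ g.
Proof.
move=> tri xf; have [[Z zZ] _] := tcat_additive T.
have triD : dist (0 : hom Z D) (idm D) (0 : hom D (susp Z)).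
  by rewrite dist_rot fmap0 oppr0; exact/dist_id/fmap_zero.
have [|y [yg _]] := dist_morph (a := 0) (b := x) tri triD.
  by rewrite xf comp0l.
by exists y; rewrite yg comp1m.
Qed.

(* [phi - 1] squares to zero: it factors through [fmap susp f] once suspended,
   and is killed by [f]. *)
Lemma dist_endo_iso (A B C : T) (f : hom A B) (g : hom B C)
    (h : hom C (susp A)) (phi : hom A A) :
  dist f g h -> f ∘ phi = f -> fmap susp phi ∘ h = h -> is_iso phi.
Proof.
move=> tri fphi phih; pose psi := phi - idm A.
have fpsi : f ∘ psi = 0 by rewrite compBr fphi compm1 subrr.
have psih : fmap susp psi ∘ h = 0.
  by rewrite fmapD fmapN fmap1 compBl phih comp1m subrr.
have [y psiE] := dist_factor ((dist_rot _ _ _).1 ((dist_rot _ _ _).1 tri)) psih.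
have psi2 : psi ∘ psi = 0.
  apply: (equivalence_faithful (susp_equiv T)); rewrite fmapM {1}psiE.
  by rewrite compNr compNl -compA -fmapM fpsi !fmap0 comp0r oppr0.
have phiE : phi = idm A + psi by rewrite addrC subrK.
clearbody psi; exists (idm A - psi); rewrite phiE; split.
  by rewrite compBl comp1m compDr compm1 psi2 addr0 addrK.
by rewrite compDl comp1m compBr compm1 psi2 subr0 subrK.
Qed.

(** The cone of [a] is isomorphic to some [susp N], and the resulting triangle is rotated back. *)
Lemma cocone_exists (t R : T) (a : hom t R) :
  exists (N : T) (u : hom N t) (w : hom R (susp N)), dist u a w.
Proof.
have [C [g [h tri]]] := dist_cone a.
have [N [e [r [re er]]]] := equivalence_ess_surj C (susp_equiv T).
have [u uE] := equivalence_full (- (h ∘ e)) (susp_equiv T).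
exists N, u, (r ∘ g); apply/dist_rot.
apply: (dist_iso (is_iso_idm t) (is_iso_idm R) _ _ _ _ tri).
- by exists e; split; [exact: er | exact: re].
- by rewrite comp1m compm1.
- by rewrite compm1.
- by rewrite uE opprK fmap1 comp1m -compA er compm1.
Qed.

(** After rotation the suspended cocones are cones of [a], [b] and [b ∘ a], so the octahedral axiom
    gives a triangle on them. Fullness of [susp] and [dist_susp] desuspend it. *)
Lemma cocone_comp (t R M U0 U N : T)
    (u0 : hom U0 t) (a : hom t R) (w0 : hom R (susp U0))
    (u : hom U R) (b : hom R M) (w : hom M (susp U))
    (n : hom N t) (c : hom M (susp N)) :
  dist u0 a w0 -> dist u b w -> dist n (b ∘ a) c ->
  exists (x : hom U0 N) (y : hom N U) (z : hom U (susp U0)), dist x y z.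
Proof.
move=> /dist_rot triA /dist_rot triB /dist_rot triC.
have [x' [y' [tri _ _ _ _]]] := dist_oct triA triB triC.
have [x xE] := equivalence_full x' (susp_equiv T).
have [y yE] := equivalence_full y' (susp_equiv T).
have [z zE] :=
  equivalence_full (- (fmap susp w0 ∘ (- fmap susp u))) (susp_equiv T).
by exists x, y, z; rewrite dist_susp xE yE zE opprK.
Qed.

Lemma dist_morph23 (A B C A' B' C' : T)
    (f : hom A B) (g : hom B C) (h : hom C (susp A))
    (f' : hom A' B') (g' : hom B' C') (h' : hom C' (susp A'))
    (b : hom B B') (c : hom C C') :
  dist f g h -> dist f' g' h' -> c ∘ g = g' ∘ b ->
  exists a : hom A A', b ∘ f = f' ∘ a /\ fmap susp a ∘ h = h' ∘ c.
Proof.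
move=> /dist_rot tri /dist_rot tri' cg.
have [a' [a'h fa']] := dist_morph tri tri' cg.
have [a aE] := equivalence_full a' (susp_equiv T).
exists a; rewrite aE; split=> //.
apply: (equivalence_faithful (susp_equiv T)); rewrite !fmapM aE.
by move: fa'; rewrite compNr compNl => /oppr_inj.
Qed.

(** The maps [i] and [p] extend to [j] and [q] on cocones. The composite [q ∘ j] may differ from the
    identity, but it belongs to a triangle endomorphism that is the identity on [t] and [R]. It is
    thus invertible, and [q] is corrected by its inverse. *)
Lemma cocone_retract (t R M N N' : T)
    (u : hom N t) (a : hom t R) (w : hom R (susp N))
    (u' : hom N' t) (b : hom t M) (w' : hom M (susp N'))
    (i : hom R M) (p : hom M R) :
  dist u a w -> dist u' b w' -> p ∘ i = idm R -> i ∘ a = b ->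
  exists (j : hom N N') (q : hom N' N), q ∘ j = idm N.
Proof.
move=> tri tri' pi ia.
have [|j [uj jw]] := dist_morph23 (b := idm t) (c := i) tri tri'.
  by rewrite ia compm1.
have [|q [uq qw]] := dist_morph23 (b := idm t) (c := p) tri' tri.
  by rewrite -ia compA pi comp1m compm1.
have [||s [sqj _]] := dist_endo_iso (phi := q ∘ j) tri.
- by rewrite compA -uq comp1m -uj comp1m.
- by rewrite fmapM -compA jw compA qw -compA pi compm1.
by exists j, (s ∘ q); rewrite -compA.
Qed.

(** * Extension closures *)

Lemma ext_closure_retract (P : T -> Prop) (A M : T)
    (i : hom A M) (p : hom M A) :
  idempotents_split T -> p ∘ i = idm A -> ext_closure P M -> ext_closure P A.
Proof.
move=> splitT /(biproduct_of_retract splitT)[B [iB [pB bi]]].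
exact: ext_closure_summand bi.
Qed.

Lemma ext_closure_susp (P : T -> Prop) (A : T) :
  (forall B, P B -> P (susp B)) -> ext_closure P A -> ext_closure P (susp A).
Proof.
move=> suspP; elim=> {A} [A /suspP/ext_closure_gen // | A B C f g h tri _ IA _ IC |
  A B M iA iB pA pB bi _ IM].
- exact: ext_closure_ext ((dist_susp _ _ _).1 tri) IA IC.
- exact: ext_closure_summand (fmap_biproduct susp bi) IM.
Qed.

Lemma ext_closure_orthogonal (P : T -> Prop) (D : T) :
  (forall A, P A -> forall f : hom A D, f = 0) ->
  forall A, ext_closure P A -> forall f : hom A D, f = 0.
Proof.
move=> PD A; elim=> {A} [A /PD // | A B C f g h tri _ IA _ IC x |
  A B M iA iB pA pB [pAiA _ _ _ _] _ IM x].
- by have [y ->] := dist_factor tri (IA (x ∘ f)); rewrite (IC y) comp0l.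
- by rewrite -(compm1 x) -pAiA compA (IM (x ∘ pA)) comp0l.
Qed.

(** * Steps and runs of the algorithm *)

Lemma rta_step_aisle (X Y P : T -> Prop) (t R0 R1 N0 N1 : T)
    (a0 : hom t R0) (a1 : hom t R1) (r : hom R0 R1)
    (u0 : hom N0 t) (w0 : hom R0 (susp N0))
    (u1 : hom N1 t) (w1 : hom R1 (susp N1)) :
  idempotents_split T -> (forall A, X A -> P A) ->
  dist u0 a0 w0 -> dist u1 a1 w1 -> rta_step X Y a0 a1 r ->
  ext_closure P N0 -> ext_closure P N1.
Proof.
move=> splitT XP tri0 tri1 [U [M [u [tr [w [XU _ triU [W [iR [iW [p [q]]]]]]]]]]].
case=> -[pi _ _ _ sumM] a1E _ qa _ PN0.
have [N [n [c triN]]] := cocone_exists (tr ∘ a0).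
have [x [y [z triE]]] := cocone_comp tri0 triU triN.
have PN : ext_closure P N.
  exact: ext_closure_ext triE PN0 (ext_closure_gen (XP _ XU)).
have [|j [s sj]] := cocone_retract tri1 triN pi.
  by rewrite a1E -[RHS]comp1m -sumM compDl -!compA qa comp0r addr0.
exact: ext_closure_retract splitT sj PN.
Qed.

Lemma rta_step_coaisle (X Y : T -> Prop) (t R0 R1 : T)
    (a0 : hom t R0) (a1 : hom t R1) (r : hom R0 R1) :
  t_structure X Y -> rta_step X Y a0 a1 r ->
  forall A, X A -> forall f : hom A R1, f = 0.
Proof.
case=> _ XY _ [U [M [u [tr [w [_ YM _ [W [iR [iW [p [q]]]]]]]]]]].
case=> -[pi _ _ _ _] _ _ _ _ A XA f.
by rewrite -(comp1m f) -pi -compA (XY _ _ XA YM (iR ∘ f)) comp0r.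
Qed.

Lemma rta_step_exists (X Y : T -> Prop) (t R0 : T) (a0 : hom t R0) :
  krull_schmidt T -> t_structure X Y ->
  exists (R1 : T) (a1 : hom t R1) (r : hom R0 R1), rta_step X Y a0 a1 r.
Proof.
move=> KS [_ _ /(_ R0)[U [M [u [tr [w [XU YM tri]]]]]]].
have [R [W [iR [iW [p [q [bi nz qa]]]]]]] := min_decomposition (tr ∘ a0) KS.
exists R, (p ∘ (tr ∘ a0)), (p ∘ tr), U, M, u, tr, w; split=> //.
by exists W, iR, iW, p, q.
Qed.

(** A run is data, while each step is only known to exist. Indefinite description turns the steps
    into a function that can be iterated. *)
Lemma rta_run_exists (d : nat) (hd : (0 < d)%N) (X Y : 'I_d -> T -> Prop)
    (t : T) :
  krull_schmidt T -> (forall i, t_structure (X i) (Y i)) ->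
  inhabited (rta_run hd X Y t).
Proof.
move=> KS tXY.
(* One stage of a run with its triangle, bundled so that the recursion has a fixed type although the
   objects vary. *)
pose state := {N : T & {R : T & {u : hom N t & {a : hom t R &
  {w : hom R (susp N) | dist u a w}}}}}.
pose RXs (s : state) := projT1 s.
pose RYs (s : state) := projT1 (projT2 s).
pose ins (s : state) : hom (RXs s) t := projT1 (projT2 (projT2 s)).
pose als (s : state) : hom t (RYs s) := projT1 (projT2 (projT2 (projT2 s))).
pose bds (s : state) : hom (RYs s) (susp (RXs s)) :=
  proj1_sig (projT2 (projT2 (projT2 (projT2 s)))).
have dists s : dist (ins s) (als s) (bds s) :=
  proj2_sig (projT2 (projT2 (projT2 (projT2 s)))).
pose step n (s s' : state) (r : hom (RYs s) (RYs s')) :=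
  rta_step (X (ord_mod hd n.+1)) (Y (ord_mod hd n.+1)) (als s) (als s') r.
have next n s : {s' : state & {r | step n s s' r}}.
  have /constructive_indefinite_description[R1] :=
    rta_step_exists (als s) KS (tXY (ord_mod hd n.+1)).
  case/constructive_indefinite_description=> a1.
  case/constructive_indefinite_description=> r stepr.
  have /constructive_indefinite_description[N1] := cocone_exists a1.
  case/constructive_indefinite_description=> u1.
  case/constructive_indefinite_description=> w1 tri1.
  exists (existT _ N1 (existT _ R1 (existT _ u1 (existT _ a1 (exist _ w1 tri1))))).
  by exists r.
have [_ _ /(_ t)[N0 [R0 [u0 [a0 [w0 [XN YR tri0]]]]]]] := tXY (ord_mod hd 0).
pose s0 : state :=
  existT _ N0 (existT _ R0 (existT _ u0 (existT _ a0 (exist _ w0 tri0)))).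
pose fix st n : state := if n is m.+1 then projT1 (next m (st m)) else s0.
constructor.
exact: (@RtaRun _ _ _ hd X Y t (fun n => RXs (st n)) (fun n => RYs (st n))
  (fun n => ins (st n)) (fun n => als (st n)) (fun n => bds (st n))
  (fun n => proj1_sig (projT2 (next n (st n)))) (fun n => dists (st n)) XN YR
  (fun n => proj2_sig (projT2 (next n (st n))))).
Qed.

End TriangulatedCategory.

(** * The t-structure obtained from termination *)

Theorem theorem2 (k : fieldType) (T : triCat k) (hKS : krull_schmidt T)
    (d : nat) (hd : (0 < d)%N) (X Y : 'I_d -> T -> Prop)
    (ht : forall i : 'I_d, t_structure (X i) (Y i))
    (hterm : forall t : T, rta_terminates hd X Y t) :
  is_aisle (ext_closure (fun A : T => exists i : 'I_d, X i A)).
Proof.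
have [splitT _ _] := hKS; set P := fun A : T => _.
exists (fun B => forall A, P A -> forall f : hom A B, f = 0).
split=> [A | A B PA PB | t].
- by apply: ext_closure_susp => B [i XB]; exists i; case: (ht i) => + _ _; apply.
- exact: ext_closure_orthogonal PB _ PA.
have [run] := rta_run_exists hd t hKS ht; have [n0 iso_n0] := hterm t run.
exists (RX run n0), (RY run n0), (rta_in run n0), (rta_alpha run n0),
  (rta_bd run n0); split; last exact: rta_dist.
  (* [RX run n] lies in the extension closure for every [n], whether or not the sequence is already
     constant. *)
  elim: {iso_n0} n0 => [|n].
    by apply: ext_closure_gen; exists (ord_mod hd 0); exact: rta_initX.
  apply: rta_step_aisle splitT _ (rta_dist run n) (rta_dist run n.+1)
    (rta_iter run n).
  by move=> A XA; exists (ord_mod hd n.+1).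
have isoRY m : exists r : hom (RY run n0) (RY run (m + n0)), is_iso r.
  elim: m => [|m [r isor]]; first by exists (idm _); exact: is_iso_idm.
  exists (rta_map run (m + n0) ∘ r); apply: is_iso_comp isor.
  exact/iso_n0/leq_addl.
move=> A [i XA] f.
(* An index [n.+1 > n0] congruent to [i] modulo [d]. *)
pose m := ((n0.+1 * d + i).-1 - n0)%N.
have mE : (m + n0).+1 = (n0.+1 * d + i)%N.
  have le_n0 : (n0 < n0.+1 * d + i)%N.
    by rewrite (leq_trans (leq_pmulr n0.+1 hd)) ?leq_addr.
  have gt0 : (0 < n0.+1 * d + i)%N := leq_ltn_trans (leq0n n0) le_n0.
  by rewrite subnK ?prednK // -ltnS prednK.
have ordE : ord_mod hd (m + n0).+1 = i.
  by apply: val_inj; rewrite /= mE modnMDl modn_small.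
(* The target of step [m + n0] is [RY run (m.+1 + n0)], which is orthogonal to [X i]. The map [f] is
   carried there by [r] and recovered by [s]. *)
have [r [s [sr _]]] := isoRY m.+1.
rewrite -(comp1m f) -sr -compA.
rewrite (rta_step_coaisle (ht _) (rta_iter run (m + n0)) _ (r ∘ f)) ?comp0r //.
by rewrite ordE.
Qed.
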